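(* Let $\mathcal{H}$ be a string hypergraph. Then $\mathrm{ara}(\mathcal{H}) = \mathrm{biara}(\mathcal{H}) = \mathrm{pd}(\mathcal{H})$. Equivalently: if $K$ is any field, $R=K[x_1,\dots,x_n]$, and $I\subset R$ is a squarefree monomial ideal such that $\mathcal{H}(I)$ is a string hypergraph, then $\mathrm{ara}\, I = \mathrm{biara}\, I = \mathrm{pd}\, R/I$.
   Context: Let $R=K[x_1,\dots,x_n]$ be a polynomial ring over a field $K$. For a squarefree monomial ideal $I$ with minimal monomial generators $m_1,\dots,m_\mu$, the associated hypergraph on the vertex set $[\mu]=\{1,\dots,\mu\}$ is $\mathcal{H}(I)=\{\{j\in[\mu]: x_i\mid m_j\} : x_i \text{ divides some } m_j\}$; its elements are called faces. A vertex $j$ is closed if $\{j\}$ is a face and open otherwise. A hypergraph $\mathcal{H}$ on $[\mu]$ ($\mu\ge 2$) is a string if $\{j,j+1\}\in\mathcal{H}$ for all $j=1,\dots,\mu-1$ and all other faces are of the form $\{j\}$. The arithmetical rank $\mathrm{ara}\, I$ is the least $u$ such that there exist $q_1,\dots,q_u\in R$ with $\sqrt{(q_1,\dots,q_u)}=\sqrt I$; the binomial arithmetical rank $\mathrm{biara}\, I$ is the same minimum where each $q_i$ is required to be a monomial or a binomial. For a hypergraph $\mathcal{H}$ of the form $\mathcal{H}(I)$, $\mathrm{pd}(\mathcal{H}):=\mathrm{pd}\, R/I$, $\mathrm{ara}(\mathcal{H}):=\mathrm{ara}\, I$, $\mathrm{biara}(\mathcal{H}):=\mathrm{biara}\, I$;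 these depend only on $\mathcal{H}$, not on the choice of $I$ (nor of the polynomial ring). *)

(* Defs.v *)
From HB Require Import structures.
From mathcomp Require Import all_boot all_order all_algebra.
From mathcomp Require Import mpoly.

Set Implicit Arguments.
Unset Strict Implicit.
Unset Printing Implicit Defensive.

Import GRing.Theory.
Local Open Scope ring_scope.

Section Defs.
Variables (K : fieldType) (n : nat).
Local Notation R := {mpoly K[n]}.

Definition sqfree_monomial (S : {set 'I_n}) : R := \prod_(i in S) 'X_i.

Definition in_ideal (k : nat) (g : 'I_k -> R) (f : R) : Prop :=
  exists c : 'I_k -> R, f = \sum_(j < k) c j * g j.

Definition in_radical (k : nat) (g : 'I_k -> R) (f : R) : Prop :=
  exists e : nat, in_ideal g (f ^+ e).

Definition mon_gens (mu : nat) (S : 'I_mu -> {set 'I_n}) : 'I_mu -> R :=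
  fun j => sqfree_monomial (S j).

Definition mono_or_binomial (q : R) : bool := (size (msupp q) <= 2)%N.

Definition ara_witness (mu : nat) (S : 'I_mu -> {set 'I_n}) (u : nat) : Prop :=
  exists q : 'I_u -> R,
    forall f : R, in_radical q f <-> in_radical (mon_gens S) f.

Definition biara_witness (mu : nat) (S : 'I_mu -> {set 'I_n}) (u : nat) : Prop :=
  exists q : 'I_u -> R, (forall j, mono_or_binomial (q j)) /\
    forall f : R, in_radical q f <-> in_radical (mon_gens S) f.

(* Free resolutions of R/I.  F_0 = R^1, F_{i+1} = R^(r i);
   d i : F_{i+1} -> F_i acts on row vectors by right multiplication. *)
Definition rank_seq (r : nat -> nat) (i : nat) : nat :=
  if i is j.+1 then r j else 1%N.

Definition free_resolution_le (mu : nat) (S : 'I_mu -> {set 'I_n}) (p : nat)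
  : Prop :=
  exists (r : nat -> nat)
         (d : forall i : nat, 'M[R]_(rank_seq r i.+1, rank_seq r i)),
    (forall i, (p < i)%N -> rank_seq r i = 0%N) /\
    (forall f : R, (exists u : 'rV[R]_(rank_seq r 1), (u *m d 0%N) 0 0 = f)
                   <-> in_ideal (mon_gens S) f) /\
    (forall (i : nat) (v : 'rV[R]_(rank_seq r i.+1)),
        v *m d i = 0 <-> exists u : 'rV[R]_(rank_seq r i.+2), v = u *m d i.+1).

End Defs.

Definition hypergraph (n mu : nat) (S : 'I_mu -> {set 'I_n})
  : {set {set 'I_mu}} :=
  [set [set j | i \in S j] | i in \bigcup_(j < mu) S j].

Definition is_string (mu : nat) (H : {set {set 'I_mu}}) : Prop :=
  (2 <= mu)%N /\
  (forall j k : 'I_mu, k = j.+1 :> nat -> [set j; k] \in H) /\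
  (forall F, F \in H ->
     #|F| = 1%N \/ exists j k : 'I_mu, k = j.+1 :> nat /\ F = [set j; k]).

Definition is_min (P : nat -> Prop) (m : nat) : Prop :=
  P m /\ forall k, P k -> (m <= k)%N.

(* Main.v *)
(** Cut the string greedily from the left: if the vertex after the current one
    is closed, cut off the current vertex alone and pay 1; if it is open, cut
    off the current vertex and the next two and pay 2.  The total cost [p] is
    the common value.

    Upper bounds.  A block of one contributes the monomial [m_j].  A block of
    three has [m_{j+1}] dividing [m_j m_{j+2}], so [m_{j+1}] and
    [m_j + m_{j+2}] generate it up to radical.  For the resolution, remove
    generators one by one from the left: a resolution of the ideal
    [J + (m)] of length [p + 1] is obtained from one of [J] of length [p + 1]
    and one of [J : m] of length [p], and [J : m] is again a string ideal, in
    which an open second generator makes the third one redundant.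

    Lower bounds.  The same cutting yields a minimal vertex cover with [p]
    elements, i.e. a minimal prime of height [p].  Setting the other variables
    to 1 turns the ideal into the maximal ideal [(y_1, ..., y_p)] up to radical,
    which needs [p] generators: if [u] polynomials suffice, comparing
    dimensions of truncations gives [t ^ p = O(t ^ u)].  The product of the
    other variables represents an element of the quotient which is annihilated
    by [p] variables, and no resolution shorter than [p] allows this. *)

Require Import Defs.
From HB Require Import structures.
From mathcomp Require Import all_boot all_order all_algebra.
From mathcomp Require Import mpoly.

Set Implicit Arguments.
Unset Strict Implicit.
Unset Printing Implicit Defensive.

Import GRing.Theory.
Local Open Scope ring_scope.

(** * Combinatorics of strings *)

Section Strings.
Local Open Scope nat_scope.
Variable T : finType.
Implicit Types (A B C D : {set T}) (L : seq {set T}).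

(** Only neighbours may share a variable: this encodes that a string has no faces other than single
    vertices and edges of consecutive ones. *)
Fixpoint sparse L : bool :=
  if L is A :: L' then all (fun D => [disjoint A & D]) (behead L') && sparse L'
  else true.

Definition linked A B :=
  [&& A :&: B != set0, ~~ (A \subset B) & ~~ (B \subset A)].

(* The greedy cutting of the string; the middle vertex [B] of a block of three
   is open, as its face variables all occur in [A] or [C]. *)
Inductive chain : seq {set T} -> nat -> Prop :=
| chain_nil : chain [::] 0
| chain_cons A L p : chain L p -> chain (A :: L) p.+1
| chain_skip A B C L p :
    B \subset A :|: C -> chain L p -> chain [:: A, B, C & L] p.+2.

(** The last clause gives each [y] a private set, met by no other element of [ys]; this is
    minimality of the cover. *)
Definition min_cover L (ys : seq T) : Prop :=
  [/\ uniq ys,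
      forall D, D \in L -> exists2 y, y \in ys & y \in D
    & forall y, y \in ys -> exists2 D, D \in L &
        y \in D /\ forall z, z \in ys -> z \in D -> z = y].

Lemma notin_disjoint x A D : [disjoint A & D] -> x \in A -> x \notin D.
Proof. by move=> dAD xA; rewrite (disjointFr dAD xA). Qed.

(* [e] is the element of the cover responsible for the first set [A]; it may
   be shared with the preceding set, but not with the following ones. *)
Lemma chain_min_cover_from N L A e :
  size L <= N -> sparse (A :: L) -> path linked A L ->
  e \in A -> (forall D, D \in L -> e \notin D) ->
  exists ys, [/\ chain (A :: L) (size ys).+1, min_cover (A :: L) (e :: ys)
    & forall y, y \in ys -> exists2 D, D \in L & y \in D].
Proof.
(* The bound [N] makes the induction strong, since a cut may remove three sets at once. *)
elim: N L A e => [|N IH] [|B L] A e //= szL spL lkL eA eL.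
1,2: exists [::]; split=> //; first exact: (chain_cons A chain_nil);
  split=> // [D /[1!inE]/eqP->|y /[1!inE]/eqP->]; exists e + exists A;
  rewrite ?inE //; split=> // z /[1!inE]/eqP-> //.
case/andP: spL => /allP dA /andP[/allP dB spL].
case/andP: lkL => /and3P[_ nAB nBA] lkL.
(* [B] is closed exactly when some [f] in it avoids both neighbours; the default [set0] stands for a
   missing right neighbour. Such an [f] then becomes responsible for [B]. *)
have [sB|] := boolP (B \subset A :|: head set0 L); last first.
  case/subsetPn=> f fB; rewrite !inE negb_or => /andP[fA fL].
  have fL' D : D \in L -> f \notin D.
    case: L fL dB {szL spL lkL eL dA} => //= C L fC dB.
    rewrite inE => /predU1P[-> //|DL]; exact: notin_disjoint (dB D DL) fB.
  case: (IH L B f) => //=; first by rewrite spL andbT; apply/allP.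
  move=> ys [ch [un cov mc] el].
  have elf y : y \in f :: ys -> exists2 D, D \in B :: L & y \in D.
    rewrite inE => /predU1P[->|/el[D DL yD]]; first by exists B; rewrite ?mem_head.
    by exists D; rewrite // inE DL orbT.
  have ney : e \notin f :: ys by apply/negP=> /elf[D /eL/negP].
  have nA z : z \in f :: ys -> z \notin A.
    rewrite inE => /predU1P[-> //|/el[D DL zD]].
    by apply: contraL zD; exact: notin_disjoint (dA D DL).
  exists (f :: ys); split=> //; first exact: chain_cons.
  split=> [|D|y]; first by rewrite cons_uniq ney.
    rewrite inE => /predU1P[->|/cov[y yy yD]]; first by exists e; rewrite ?mem_head.
    by exists y; rewrite // inE yy orbT.
  rewrite inE => /predU1P[->|yy].
    exists A; rewrite ?mem_head //; split=> // z.
    by rewrite inE => /predU1P[-> //|/nA/negPf->].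
  case: (mc y yy) => D DL [yD uD]; exists D; first by rewrite inE DL orbT.
  split=> // z; rewrite inE => /predU1P[->|]; last exact: uD.
  by move/negPf: (eL D DL) => ->.
(* An open [B] must have a right neighbour, for otherwise it would be contained in [A]. *)
case: L sB dA dB spL lkL szL eL => [|C L] /= sB dA dB spL lkL szL eL.
  by rewrite setU0 (negPf nBA) in sB.
(* A variable [y] common to [B] and [C] covers both, with [B] as its private set. *)
case/andP: lkL => /and3P[/set0Pn[y /[1!inE]/andP[yB yC]] _ _] lkL.
have eB : e \notin B by apply: eL; rewrite mem_head.
have eC : e \notin C by apply: eL; rewrite !inE eqxx orbT.
have yA : y \notin A.
  apply: contraL yC; apply: notin_disjoint; apply: dA; exact: mem_head.
have yL D : D \in L -> y \notin D.
  by move=> DL; apply: notin_disjoint yB; exact: dB.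
have nye : y != e by apply: contraNneq yA => ->.
case: L dA dB spL lkL szL eL yL => [|D L] dA dB spL lkL szL eL yL.
  exists [:: y]; split=> [||z /[1!inE]/eqP->]; last by exists B; rewrite ?mem_head.
    exact: (chain_skip sB chain_nil).
  split=> [|D|z]; first by rewrite /= inE eq_sym nye.
    rewrite !inE => /or3P[]/eqP->; [exists e|exists y|exists y];
      by rewrite ?inE ?eqxx ?orbT.
  rewrite !inE => /orP[]/eqP->; [exists A|exists B]; rewrite ?inE ?eqxx ?orbT //;
    split=> // w; rewrite !inE => /orP[]/eqP-> //.
    by rewrite (negPf yA).
  by rewrite (negPf eB).
case/andP: spL => /allP dC spL.
(* Taking [f] from [C] as well as [D] keeps it out of all sets after [D]. Then [C] is met twice,
   which is harmless because it is nobody's private set. *)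
move: lkL => /= /andP[/and3P[/set0Pn[f /[1!inE]/andP[fC fD]] _ _] lkL].
case: (IH L D f) => //=.
  - by apply: leq_trans (ltnSE szL); do 2!apply: leqW.
  - by move=> E EL; apply: notin_disjoint fC; apply: dC.
move=> ys [ch [un cov mc] el].
have elf z : z \in f :: ys -> exists2 E, E \in D :: L & z \in E.
  rewrite inE => /predU1P[->|/el[E EL zE]]; first by exists D; rewrite ?mem_head.
  by exists E; rewrite // inE EL orbT.
have far (X : {set T}) z : (forall E, E \in D :: L -> [disjoint X & E]) ->
    z \in f :: ys -> z \notin X.
  by move=> dX /elf[E EL zE]; apply: contraL zE; exact: notin_disjoint (dX E EL).
have nA z : z \in f :: ys -> z \notin A.
  by apply: far => E EL; apply: dA; rewrite inE EL orbT.
have nB z : z \in f :: ys -> z \notin B by apply: far => E EL; apply: dB.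
exists [:: y, f & ys]; split.
- exact: chain_skip.
- split=> [|E|z].
  + rewrite cons_uniq in_cons negb_or eq_sym nye cons_uniq un andbT /=.
    by apply/andP; split; [apply: contraL eA; exact: nA|apply: contraL yB; exact: nB].
  + rewrite 3!in_cons => /or4P[/eqP->|/eqP->|/eqP->|].
    * by exists e; rewrite ?mem_head.
    * by exists y; rewrite // !inE eqxx orbT.
    * by exists y; rewrite // !inE eqxx orbT.
    by case/cov=> z zz zE; exists z; rewrite // 2!in_cons zz !orbT.
  + rewrite inE => /predU1P[->|].
      exists A; rewrite ?mem_head //; split=> // w.
      rewrite inE => /predU1P[-> //|]; rewrite inE => /predU1P[->|/nA/negPf-> //].
      by rewrite (negPf yA).
    rewrite inE => /predU1P[->|zz].
      exists B; rewrite ?inE ?eqxx ?orbT //; split=> // w.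
      rewrite inE => /predU1P[->|]; first by rewrite (negPf eB).
      by rewrite inE => /predU1P[-> //|/nB/negPf->].
    case: (mc z zz) => E EL [zE uE]; exists E.
      by rewrite 3!in_cons EL !orbT.
    split=> // w; rewrite inE => /predU1P[->|].
      by rewrite (negPf (eL E _)) // 2!in_cons EL !orbT.
    by rewrite inE => /predU1P[->|]; [rewrite (negPf (yL E EL))|exact: uE].
move=> z; rewrite inE => /predU1P[->|/elf[E EL zE]]; first by exists B; rewrite ?mem_head.
by exists E; rewrite // 2!in_cons EL !orbT.
Qed.

(** The first element is a variable of [A] outside [B]; sparsity keeps it out of all later sets. *)
Lemma chain_min_cover A B L :
    sparse [:: A, B & L] -> path linked A (B :: L) ->
  exists ys, chain [:: A, B & L] (size ys) /\ min_cover [:: A, B & L] ys.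
Proof.
move=> spL lkL; have /= /andP[/and3P[_ /subsetPn[e eA eB] _] _] := lkL.
have eL D : D \in B :: L -> e \notin D.
  case/andP: spL => /allP dA _; rewrite inE => /predU1P[-> //|/dA dAD].
  exact: notin_disjoint eA.
have [ys [ch cov _]] := chain_min_cover_from (leqnn _) spL lkL eA eL.
by exists (e :: ys).
Qed.

End Strings.

(** * Lengths of free resolutions *)

Section ProjectiveDimension.
Variable A : comNzRingType.

(* [pd_le p N]: the cokernel of N, a submodule of A^r, has a finite free
   resolution of length at most [p] starting with A^r. *)
Fixpoint pd_le (p r : nat) (N : 'rV[A]_r -> Prop) : Prop :=
  if p is q.+1 then
    exists m (M : 'M[A]_(m, r)),
      (forall v, N v <-> exists u, v = u *m M) /\ pd_le q (fun u => u *m M = 0)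
  else forall v, N v <-> v = 0.

Lemma pd_le_ext p r (N N' : 'rV[A]_r -> Prop) :
  (forall v, N v <-> N' v) -> pd_le p N -> pd_le p N'.
Proof.
case: p => [|p] /= eN.
  by move=> N0 v; split=> [/eN/N0|/N0/eN].
case=> m [M [gM kM]]; exists m, M; split=> // v.
by split=> [/eN/gM|/gM/eN].
Qed.

Definition submodule r (N : 'rV[A]_r -> Prop) : Prop :=
  [/\ N 0, forall u v, N u -> N v -> N (u + v) & forall a u, N u -> N (a *: u)].

Lemma submodule_ker r s (M : 'M[A]_(r, s)) : submodule (fun u => u *m M = 0).
Proof.
split=> [|u v Mu Mv|a u Mu]; first exact: mul0mx.
  by rewrite mulmxDl Mu Mv addr0.
by rewrite -scalemxAl Mu scaler0.
Qed.

Lemma submodule_mulmx r m (N : 'rV[A]_r -> Prop) (M : 'M[A]_(m, r)) u :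
  submodule N -> (forall i, N (row i M)) -> N (u *m M).
Proof.
case=> N0 ND NZ NM; rewrite mulmx_sum_row.
by elim/big_ind: _ => // i _; apply: NZ.
Qed.

Lemma pd_le_succ p r (N : 'rV[A]_r -> Prop) : pd_le p N -> pd_le p.+1 N.
Proof.
elim: p r N => [|p IH] r N.
  move=> N0; exists 0%N, 0; split=> [v|u].
    split=> [/N0->|[u ->]]; first by exists 0; rewrite mul0mx.
    by apply/N0; rewrite mulmx0.
  by rewrite mulmx0; split=> // _; apply/rowP; case.
by case=> m [M [gM kM]]; exists m, M; split=> //; apply: IH.
Qed.

(* The horseshoe lemma for the coordinate projection of [N] onto A^r2. *)
Lemma pd_le_extension p r1 r2 (N : 'rV[A]_(r1 + r2) -> Prop) :
  submodule N -> pd_le p (fun v => N (row_mx v 0)) ->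
  pd_le p (fun w => exists v, N (row_mx v w)) -> pd_le p N.
Proof.
elim: p r1 r2 N => [|p IH] r1 r2 N sN /=.
  move=> N1 N2 x; split=> [Nx|->]; last by case: sN.
  have x2 : rsubmx x = 0 by apply/N2; exists (lsubmx x); rewrite hsubmxK.
  have x1 : lsubmx x = 0 by apply/N1; rewrite -x2 hsubmxK.
  by rewrite -(hsubmxK x) x1 x2 row_mx0.
case=> m1 [M1 [g1 k1]] [m2 [M2 [g2 k2]]].
have [v vP] : exists v : 'I_m2 -> 'rV_r1, forall i, N (row_mx (v i) (row i M2)).
  suff /fin_all_exists[v vP] i : exists v : 'rV_r1, N (row_mx v (row i M2)) by exists v.
  apply/g2.
  by exists (delta_mx 0 i); rewrite rowE.
pose L := \matrix_i v i.
have NL w : N (row_mx (w *m L) (w *m M2)).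
  rewrite -mul_mx_row; apply: submodule_mulmx => // i.
  by rewrite row_row_mx rowK.
have N10 u : N (row_mx (u *m M1) 0) by apply/g1; exists u.
(* The rows of [M1] generate the kernel of the projection, and those of [row_mx L M2] lift
   generators of its image. *)
exists (m1 + m2)%N, (block_mx M1 0 L M2); split=> [x|].
  split=> [Nx|[u ->]].
    have /g2[w xw] : exists v, N (row_mx v (rsubmx x)).
      by exists (lsubmx x); rewrite hsubmxK.
    have /g1[u xu] : N (row_mx (lsubmx x - w *m L) 0).
      case: sN => _ ND NZ.
      have -> : row_mx (lsubmx x - w *m L) 0 = x + (-1) *: row_mx (w *m L) (w *m M2).
        by rewrite scaleN1r -{2}[x]hsubmxK xw opp_row_mx add_row_mx subrr.
      by apply: ND => //; apply: NZ.
    exists (row_mx u w); rewrite mul_row_block mulmx0 add0r -xu subrK -xw.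
    by rewrite hsubmxK.
  rewrite -(hsubmxK u) mul_row_block mulmx0 add0r.
  have -> : row_mx (lsubmx u *m M1 + rsubmx u *m L) (rsubmx u *m M2) =
     row_mx (lsubmx u *m M1) 0 + row_mx (rsubmx u *m L) (rsubmx u *m M2).
    by rewrite add_row_mx add0r.
  by case: sN => _ ND _; apply: ND.
(* The syzygies form an extension again: those with second component 0 come from [M1], and a syzygy
   [w] of [M2] lifts because [w *m L] is a combination of the rows of [M1]. *)
apply: IH; first exact: submodule_ker.
  apply: pd_le_ext k1 => u; rewrite mul_row_block mulmx0 add0r !mul0mx addr0.
  by split=> [->|/eqP]; rewrite ?row_mx0 // row_mx_eq0 => /andP[/eqP].
apply: pd_le_ext k2 => w; split=> [w0|[u]].
  have /g1[u xu] : N (row_mx (w *m L) 0) by rewrite -w0.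
  by exists (- u); rewrite mul_row_block mulmx0 add0r mulNmx -xu addNr w0 row_mx0.
rewrite mul_row_block mulmx0 add0r => /eqP.
by rewrite row_mx_eq0 => /andP[_ /eqP].
Qed.

(** Projecting a syzygy of the generators of [J] followed by [a] to its last coordinate has the
    syzygies of [J] as kernel and the colon ideal [J : a] as image, so [pd_le_extension] applies one
    step up. *)
Lemma pd_le_add_gen p (J I : A -> Prop) a :
  submodule (fun v : 'rV_1 => J (v 0 0)) ->
  (forall f, I f <-> exists c g, J g /\ f = g + c * a) ->
  pd_le p.+1 (fun v : 'rV_1 => J (v 0 0)) ->
  pd_le p (fun v : 'rV_1 => J (v 0 0 * a)) ->
  pd_le p.+1 (fun v : 'rV_1 => I (v 0 0)).
Proof.
move=> sJ eI [m [M [gM kM]]] kJ.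
have eJ g : J g <-> exists u, g%:M = u *m M.
  by have /= := gM g%:M; rewrite mxE eqxx mulr1n.
exists (m + 1)%N, (col_mx M a%:M); split=> [v|].
  split=> [/eI[c [g [/eJ[u gu] vE]]]|[u ->]].
    exists (row_mx u c%:M); rewrite mul_row_col -gu -scalar_mxM -raddfD -vE.
    by rewrite [LHS]mx11_scalar.
  rewrite -(hsubmxK u) mul_row_col; apply/eI.
  exists (rsubmx u 0 0), ((lsubmx u *m M) 0 0); split.
    by apply/eJ; exists (lsubmx u); rewrite -mx11_scalar.
  by rewrite [rsubmx u in LHS]mx11_scalar -scalar_mxM !mxE eqxx mulr1n.
apply: pd_le_extension; first exact: submodule_ker.
  by apply: pd_le_ext kM => u; rewrite mul_row_col mul0mx addr0.
apply: pd_le_ext kJ => w; split=> [/eJ[u ua]|[u]].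
  by exists (- u); rewrite mul_row_col mulNmx -ua {2}(mx11_scalar w) -scalar_mxM
                   addNr.
rewrite mul_row_col {1}(mx11_scalar w) -scalar_mxM => /eqP.
rewrite addrC addr_eq0 => /eqP wu; apply/eJ; exists (- u).
by rewrite mulNmx -wu.
Qed.

(** This is [rank_seq] with an arbitrary rank in degree 0, so that an induction can restart at the
    syzygies. *)
Definition rank_from (r0 : nat) (r : nat -> nat) (i : nat) : nat :=
  if i is j.+1 then r j else r0.

Lemma pd_le_resolution p r0 (N : 'rV[A]_r0 -> Prop) :
  pd_le p N ->
  exists (r : nat -> nat)
      (d : forall i, 'M[A]_(rank_from r0 r i.+1, rank_from r0 r i)),
    [/\ forall i, (p < i)%N -> rank_from r0 r i = 0%N,
        forall v, N v <-> exists u, v = u *m d 0%N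
      & forall i (v : 'rV_(rank_from r0 r i.+1)),
          v *m d i = 0 <-> exists u : 'rV_(rank_from r0 r i.+2), v = u *m d i.+1].
Proof.
elim: p r0 N => [|p IH] r0 N /=.
  move=> N0; exists (fun=> 0%N), (fun=> 0); split=> [[]//|v|i v].
    split=> [/N0->|[u ->]]; first by exists 0; rewrite mul0mx.
    by apply/N0; rewrite mulmx0.
  split=> _; last by rewrite mulmx0.
  by exists 0; rewrite mul0mx; apply/rowP; case.
case=> m [M [gM /IH[r [d [r0p d0 dE]]]]].
pose r' := rank_from m r.
pose d' i : 'M[A]_(rank_from r0 r' i.+1, rank_from r0 r' i) :=
  match i with 0%N => M | j.+1 => d j end.
exists r', d'; split=> //.
  by case=> // i; exact: r0p.
by case=> [|i] v //; exact: dE.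
Qed.
End ProjectiveDimension.

(** * Monomial ideals *)

Section MonomialIdeals.
Variables (K : fieldType) (n : nat).
Local Notation R := {mpoly K[n]}.
Implicit Types (A B T : {set 'I_n}) (L : seq {set 'I_n}) (m : 'X_{1..n}) (f g : R).

Definition mnm_set m : {set 'I_n} := [set i | m i != 0%N].

Lemma mnm_setD m1 m2 : mnm_set (m1 + m2) = mnm_set m1 :|: mnm_set m2.
Proof. by apply/setP => i; rewrite !inE mnmDE addn_eq0 negb_and. Qed.

Lemma mnm_set_mesym1 A : mnm_set (mesym1 A) = A.
Proof. by apply/setP => i; rewrite inE mnmE eqb0 negbK. Qed.

Lemma mesym1_le A m : (mesym1 A <= m)%MM = (A \subset mnm_set m).
Proof.
apply/mnm_lepP/subsetP => [leAm i iA|sAm i].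
  by rewrite inE -lt0n; apply: leq_trans (leAm i); rewrite mnmE iA.
by rewrite mnmE; case: (boolP (i \in A)) => // /sAm; rewrite inE lt0n.
Qed.

Lemma sqfree_monomialE A : sqfree_monomial K A = 'X_[mesym1 A].
Proof.
rewrite mpolyXE_id /sqfree_monomial [RHS](bigID (mem A)) /= [X in _ * X]big1 ?mulr1.
  by apply: eq_bigr => i iA; rewrite mnmE iA.
by move=> i /negPf iA; rewrite mnmE iA.
Qed.

(** Membership is tested on the support, without choosing coefficients; [in_ideal_mon_gens]
    identifies it with the ideal generated by the monomials. *)
Definition mon_ideal L f : Prop :=
  forall m, m \in msupp f -> has (fun A => A \subset mnm_set m) L.

Lemma mon_ideal_mull L g f : mon_ideal L f -> mon_ideal L (g * f).
Proof.
move=> Lf m /msuppM_le/allpairsP[[m1 m2] /= [_ /Lf Lm2 ->]].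
apply: sub_has Lm2 => A sA; rewrite mnm_setD; exact: subset_trans sA (subsetUr _ _).
Qed.

Lemma mon_ideal0 L : mon_ideal L 0.
Proof. by move=> m; rewrite msupp0. Qed.

Lemma mon_idealD L f g : mon_ideal L f -> mon_ideal L g -> mon_ideal L (f + g).
Proof. by move=> Lf Lg m /msuppD_le; rewrite mem_cat => /orP[/Lf|/Lg]. Qed.

Lemma mon_idealX L A : A \in L -> mon_ideal L (sqfree_monomial K A).
Proof.
move=> AL m; rewrite sqfree_monomialE => /mem_msuppXP <-.
by apply/hasP; exists A => //; rewrite mnm_set_mesym1.
Qed.

Lemma submodule_mon_ideal L : submodule (fun v : 'rV_1 => mon_ideal L (v 0 0)).
Proof.
split=> [|u v Lu Lv|a u Lu]; rewrite !mxE; first exact: mon_ideal0.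
  exact: mon_idealD.
exact: mon_ideal_mull.
Qed.

(** Multiplication by the monomial of [T] shifts the support, and [A] is contained in the union of
    [T] and a set exactly when [A :\: T] is contained in that set. *)
Lemma mon_ideal_colon L T f :
  mon_ideal L (f * sqfree_monomial K T) <-> mon_ideal [seq A :\: T | A <- L] f.
Proof.
have eT m : has (fun A => A \subset mnm_set (mesym1 T + m)) L =
            has (fun A => A \subset mnm_set m) [seq A :\: T | A <- L].
  rewrite has_map; apply: eq_has => A /=.
  by rewrite mnm_setD mnm_set_mesym1 subDset.
rewrite sqfree_monomialE; split=> Lf m mf.
  rewrite -eT; apply: Lf; rewrite (perm_mem (msuppMX _ _)).
  by apply/mapP; exists m.
move: mf; rewrite (perm_mem (msuppMX _ _)) => /mapP[m' m'f ->].
by rewrite eT; apply: Lf.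
Qed.

Lemma mon_ideal_cons T L f :
  mon_ideal (T :: L) f <->
  exists c g, mon_ideal L g /\ f = g + c * sqfree_monomial K T.
Proof.
split=> [Lf|[c [g [Lg ->]]]]; last first.
  apply: mon_idealD => [m /Lg Lm|]; first by rewrite /= Lm orbT.
  by apply: mon_ideal_mull; apply: mon_idealX; rewrite mem_head.
pose P m := has (fun A => A \subset mnm_set m) L.
(* The terms of [f] already in the ideal of [L] make up [g]; every other term is divisible by the
   monomial of [T]. *)
exists (\sum_(m <- msupp f | ~~ P m) f@_m *: 'X_[m - mesym1 T]).
exists (\sum_(m <- msupp f | P m) f@_m *: 'X_[m]); split.
  apply: big_ind => [|g h|m Pm]; [exact: mon_ideal0|exact: mon_idealD|].
  by move=> m' /msuppZ_le/mem_msuppXP <-.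
rewrite {1}[f]mpolyE (bigID P) /=; congr (_ + _).
rewrite mulr_suml big_seq_cond [RHS]big_seq_cond; apply: eq_bigr => m /andP[mf Pm].
have := Lf m mf; rewrite /= -/(P m) (negPf Pm) orbF -mesym1_le => leTm.
by rewrite -scalerAl sqfree_monomialE -mpolyXD submK.
Qed.

Lemma mon_ideal_sub L L' f :
  (forall A, A \in L -> exists2 B, B \in L' & B \subset A) ->
  mon_ideal L f -> mon_ideal L' f.
Proof.
move=> sL Lf m /Lf/hasP[A /sL[B BL' sBA] sA]; apply/hasP; exists B => //.
exact: subset_trans sA.
Qed.

Lemma mon_ideal_nil f : mon_ideal [::] f <-> f = 0.
Proof.
split=> [f0|->]; last exact: mon_ideal0.
apply/eqP; rewrite -msupp_eq0; case E: (msupp f) => [//|m s].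
by have /= := f0 m; rewrite E mem_head => /(_ isT).
Qed.

Definition pd_mon_le p L := pd_le p (fun v : 'rV[R]_1 => mon_ideal L (v 0 0)).

Lemma pd_mon_le_cons p T L :
  pd_mon_le p.+1 L -> pd_mon_le p [seq A :\: T | A <- L] ->
  pd_mon_le p.+1 (T :: L).
Proof.
move=> pdL pdT; apply: (pd_le_add_gen (submodule_mon_ideal L)) pdL _.
  by move=> f; apply: mon_ideal_cons.
by apply: pd_le_ext pdT => v; split=> /mon_ideal_colon.
Qed.

Lemma map_setD_disjoint T L :
  all (fun D : {set _} => [disjoint T & D]) L -> [seq A :\: T | A <- L] = L.
Proof.
move=> /allP dT; rewrite -[RHS]map_id; apply/eq_in_map => A /dT dTA.
by apply/setDidPl; rewrite disjoint_sym.
Qed.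

Lemma disjoint_setDl T B L : all (fun D : {set _} => [disjoint B & D]) L ->
  all (fun D : {set _} => [disjoint B :\: T & D]) L.
Proof. by apply: sub_all => D; apply: disjointWl; apply: subsetDl. Qed.

(** A skip survives because the middle set contains no element of [T]: whatever it shares with [B]
    is still there. *)
Lemma chain_setD_head T B L p : all (fun D : {set _} => [disjoint T & D]) L ->
  chain (B :: L) p -> chain (B :\: T :: L) p.
Proof.
move=> dT; inversion 1; subst; first exact: chain_cons.
apply: chain_skip => //; apply/subsetP => x xC.
have := subsetP H2 x xC; rewrite !inE; case/orP=> [xB|->]; last by rewrite orbT.
by rewrite xB; case/andP: dT => dTC _; rewrite (disjointFl dTC xC).
Qed.

Lemma pd_mon_le_sparse p L : sparse L -> chain L p -> pd_mon_le p L.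
Proof.
have [q] := ubnP p; elim: q p L => // q IH p L ltpq spL chL.
(* Passing to the colon by [A] alters only the head of [L1], so the colon ideal has a chain of the
   same cost. *)
have pd_cons A L1 p1 : (p1 < q)%N -> sparse (A :: L1) -> chain L1 p1 ->
    pd_mon_le p1.+1 (A :: L1).
  move=> ltp1 spA ch1; have /andP[dA sp1] := spA.
  apply: pd_mon_le_cons; first by apply: pd_le_succ; apply: IH.
  apply: IH => //.
    case: L1 dA sp1 {spA ch1} => // B L1 dA /andP[dB spB].
    rewrite map_cons map_setD_disjoint //; apply/andP; split=> //.
    exact: disjoint_setDl.
  case: L1 dA ch1 {spA sp1} => // B L1 dA ch1.
  by rewrite map_cons map_setD_disjoint //; apply: chain_setD_head.
case: chL spL ltpq => [|A L1 p1 ch1|A B C L1 p1 sB ch1] spL ltpq.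
- move=> v; rewrite mon_ideal_nil; split=> [v0|->]; last by rewrite mxE.
  by rewrite [v]mx11_scalar v0 raddf0.
- exact: pd_cons.
case/andP: spL => dA /andP[dB /andP[dC sp1]].
apply: pd_mon_le_cons.
  apply: pd_cons => //; last exact: chain_cons.
  by apply/andP; split; last (apply/andP; split).
rewrite map_cons map_setD_disjoint //.
(* Openness of [B] places [B :\: A] inside [C], so [C] is redundant in the colon ideal, which then
   costs only one more than [L1]. *)
have: pd_mon_le p1.+1 (B :\: A :: L1).
  apply: pd_cons => //; first exact: ltnW.
  apply/andP; split=> //; apply: disjoint_setDl.
  by case: (L1) dB => // D L2 /andP[].
apply: pd_le_ext => v; split; apply: mon_ideal_sub => D.
  rewrite inE => /predU1P[->|DL]; first by exists (B :\: A); rewrite ?mem_head.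
  by exists D; rewrite // 2!in_cons DL !orbT.
rewrite 2!in_cons => /or3P[/eqP->|/eqP->|DL].
- by exists (B :\: A); rewrite ?mem_head.
- by exists (B :\: A); rewrite ?mem_head // subDset.
- by exists D; rewrite // in_cons DL orbT.
Qed.

End MonomialIdeals.

(** * Radicals *)

Section Radicals.
Variables (K : fieldType) (n : nat).
Local Notation R := {mpoly K[n]}.
Implicit Types (A B T : {set 'I_n}) (L : seq {set 'I_n}) (f : R).

Lemma in_ideal0 k (g : 'I_k -> R) : in_ideal g 0.
Proof. by exists (fun=> 0); rewrite big1 // => j _; rewrite mul0r. Qed.

Lemma in_idealD k (g : 'I_k -> R) f1 f2 :
  in_ideal g f1 -> in_ideal g f2 -> in_ideal g (f1 + f2).
Proof.
move=> [c1 ->] [c2 ->]; exists (fun j => c1 j + c2 j).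
by rewrite -big_split; apply: eq_bigr => j _; rewrite mulrDl.
Qed.

Lemma in_idealM k (g : 'I_k -> R) a f : in_ideal g f -> in_ideal g (a * f).
Proof.
move=> [c ->]; exists (fun j => a * c j).
by rewrite mulr_sumr; apply: eq_bigr => j _; rewrite mulrA.
Qed.

Lemma in_ideal_gen k (g : 'I_k -> R) j : in_ideal g (g j).
Proof.
exists (fun i => (i == j)%:R); rewrite (bigD1 j) //= eqxx mul1r big1 ?addr0 //.
by move=> i /negPf->; rewrite mul0r.
Qed.

Lemma in_radical_ideal k (g : 'I_k -> R) f : in_ideal g f -> in_radical g f.
Proof. by exists 1%N. Qed.

Lemma in_radicalD k (g : 'I_k -> R) f1 f2 :
  in_radical g f1 -> in_radical g f2 -> in_radical g (f1 + f2).
Proof.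
move=> [a f1a] [b f2b]; exists (a + b)%N; rewrite exprDn.
elim/big_ind: _ => [||i _]; [exact: in_ideal0|exact: in_idealD|].
rewrite -mulr_natl; apply: in_idealM; have [leib|ltbi] := leqP i b.
  by rewrite mulrC -addnBA // exprD [f1 ^+ a * _]mulrC mulrA; apply: in_idealM.
by rewrite -(subnK (ltnW ltbi)) [f2 ^+ _]exprD mulrA; apply: in_idealM.
Qed.

Lemma in_radicalM k (g : 'I_k -> R) a f : in_radical g f -> in_radical g (a * f).
Proof. by move=> [e fe]; exists e; rewrite exprMn; apply: in_idealM. Qed.

Lemma in_radical_trans k l (g : 'I_k -> R) (h : 'I_l -> R) f :
  (forall j, in_radical h (g j)) -> in_radical g f -> in_radical h f.
Proof.
move=> hg [e [c fe]]; suff [a ha] : in_radical h (f ^+ e).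
  by exists (e * a)%N; rewrite exprM.
rewrite fe; elim/big_ind: _ => [||i _]; first exact/in_radical_ideal/in_ideal0.
  exact: in_radicalD.
exact: in_radicalM.
Qed.

Lemma in_ideal_mon_gens mu (S : 'I_mu -> {set 'I_n}) f :
  in_ideal (mon_gens K S) f <-> mon_ideal (codom S) f.
Proof.
split=> [[c ->]|Sf].
  elim/big_ind: _ => [||j _]; [exact: mon_ideal0|exact: mon_idealD|].
  by apply/mon_ideal_mull/mon_idealX/codom_f.
rewrite [f]mpolyE big_seq; elim/big_ind: _ => [||m /Sf/hasP[_ /codomP[j ->] sSm]].
- exact: in_ideal0.
- exact: in_idealD.
have -> : f@_m *: 'X_[m] = (f@_m *: 'X_[m - mesym1 (S j)]) * mon_gens K S j.
  by rewrite -scalerAl /mon_gens sqfree_monomialE -mpolyXD submK // mesym1_le.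
exact/in_idealM/in_ideal_gen.
Qed.

Lemma mono_or_binomialX (m : 'X_{1..n}) : mono_or_binomial ('X_[m] : R).
Proof. by rewrite /mono_or_binomial msuppX. Qed.

Lemma mono_or_binomialXD (m m' : 'X_{1..n}) :
  mono_or_binomial ('X_[m] + 'X_[m'] : R).
Proof.
apply: (@uniq_leq_size _ _ [:: m; m']) => // i /msuppD_le.
by rewrite !msuppX.
Qed.

(** In a block of three, [X A] and [X C] are the roots of the polynomial t^2 - (X A + X C) t + X A X
    C. Its lower coefficients lie in the ideal of the two chosen generators, so both roots lie in
    the radical. *)
Lemma chain_binomials L p : chain L p ->
  exists q : 'I_p -> R,
    [/\ forall j, mono_or_binomial (q j), forall j, mon_ideal L (q j)
      & forall A, A \in L -> in_radical q (sqfree_monomial K A)].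
Proof.
have cons_gens k (q : 'I_k -> R) (q' : 'I_k.+1 -> R) f :
    (forall j, q' (lift ord0 j) = q j) -> in_radical q f -> in_radical q' f.
  by move=> q'E; apply: in_radical_trans => j; rewrite -q'E;
    apply/in_radical_ideal/in_ideal_gen.
pose qcons k (a : R) (q : 'I_k -> R) (j : 'I_k.+1) := oapp q a (unlift ord0 j).
have qcons0 k a (q : 'I_k -> R) : qcons k a q ord0 = a.
  by rewrite /qcons unlift_none.
have qconsS k a (q : 'I_k -> R) j : qcons k a q (lift ord0 j) = q j.
  by rewrite /qcons liftK.
have rad0 k a (q : 'I_k -> R) : in_radical (qcons k a q) a.
  by rewrite -{2}(qcons0 k a q); apply/in_radical_ideal/in_ideal_gen.
have radS k a (q : 'I_k -> R) f : in_radical q f -> in_radical (qcons k a q) f.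
  exact: cons_gens (qconsS k a q).
have qconsP k a (q : 'I_k -> R) (P : R -> Prop) :
    P a -> (forall j, P (q j)) -> forall j, P (qcons k a q j).
  by move=> Pa Pq j; rewrite /qcons; case: unliftP => [i|] _ /=.
elim=> {L p} [|A L p _ [q [q2 qL qr]]|A B C L p sB _ [q [q2 qL qr]]].
- by exists (fun=> 0); split=> // -[].
- exists (qcons p (sqfree_monomial K A) q); split=> [||D].
  + by apply: (qconsP _ _ _ (fun f => mono_or_binomial f)) => //;
      rewrite sqfree_monomialE mono_or_binomialX.
  + apply: (qconsP _ _ _ (mon_ideal _)) => [|j].
      by apply: mon_idealX; rewrite mem_head.
    apply: mon_ideal_sub (qL j) => D DL; exists D => //.
    by rewrite in_cons DL orbT.
  + by rewrite inE => /predU1P[->|/qr]; [apply: rad0|apply: radS].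
pose X (D : {set 'I_n}) := sqfree_monomial K D.
pose q1 := qcons p (X A + X C) q; pose q0 := qcons p.+1 (X B) q1.
have rB : in_radical q0 (X B) by apply: rad0.
have rAC : in_radical q0 (X A + X C) by apply/radS/rad0.
have [c XAC] : exists c, X A * X C = c * X B.
  exists 'X_[mesym1 A + mesym1 C - mesym1 B].
  rewrite /X !sqfree_monomialE -!mpolyXD submK // mesym1_le.
  by rewrite mnm_setD !mnm_set_mesym1.
have rA : in_radical q0 (X A).
  have [e Ae] : in_radical q0 (X A ^+ 2).
    have -> : X A ^+ 2 = X A * (X A + X C) + (- c) * X B.
      by rewrite mulrDr XAC mulNr addrK.
    by apply: in_radicalD; apply: in_radicalM.
  by exists (2 * e)%N; rewrite exprM.
have rC : in_radical q0 (X C).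
  by rewrite -(addKr (X A) (X C)) -mulN1r; apply: in_radicalD => //; apply: in_radicalM.
have LX D : D \in [:: A, B, C & L] -> mon_ideal [:: A, B, C & L] (X D).
  exact: mon_idealX.
exists q0; split=> [||D].
- apply: (qconsP _ _ _ (fun f => mono_or_binomial f)).
    by rewrite /X sqfree_monomialE mono_or_binomialX.
  by apply: (qconsP _ _ _ (fun f => mono_or_binomial f)) => //;
    rewrite /X !sqfree_monomialE mono_or_binomialXD.
- apply: (qconsP _ _ _ (mon_ideal _)); first by apply: LX; rewrite !in_cons eqxx orbT.
  apply: (qconsP _ _ _ (mon_ideal _)) => [|j].
    by apply: mon_idealD; apply: LX; rewrite !in_cons eqxx ?orbT.
  apply: mon_ideal_sub (qL j) => D DL; exists D => //.
  by rewrite 3!in_cons DL !orbT.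
- rewrite 3!in_cons => /or4P[/eqP->|/eqP->|/eqP->|/qr] //.
  by move=> rD; apply/radS/radS.
Qed.

Lemma chain_biara_witness mu (S : 'I_mu -> {set 'I_n}) p :
  chain (codom S) p -> biara_witness K S p.
Proof.
case/chain_binomials=> q [q2 qS qr]; exists q; split=> // f.
split; apply: in_radical_trans => j; last exact/qr/codom_f.
exact/in_radical_ideal/in_ideal_mon_gens.
Qed.

Lemma biara_ara_witness mu (S : 'I_mu -> {set 'I_n}) p :
  biara_witness K S p -> ara_witness K S p.
Proof. by case=> q [_ qr]; exists q. Qed.

Lemma chain_free_resolution mu (S : 'I_mu -> {set 'I_n}) p :
  sparse (codom S) -> chain (codom S) p -> free_resolution_le K S p.
Proof.
move=> spS /(pd_mon_le_sparse K spS)/pd_le_resolution[r [d [rp d0 dE]]].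
exists r, d; split=> //; split=> // f; rewrite in_ideal_mon_gens.
split=> [[u <-]|Sf]; first by apply/d0; exists u.
have /d0[u uE] : mon_ideal (codom S) ((f%:M : 'rV_1) 0 0) by rewrite mxE mulr1n.
by exists u; rewrite -uE mxE mulr1n.
Qed.
End Radicals.

(** * A height bound for the irrelevant ideal *)

Section HeightBound.
Variables (K : fieldType) (p u : nat).
Local Notation R := {mpoly K[p]}.
Implicit Types (f g h : R) (m : 'X_{1..p}) (al : 'X_{1..u}).

(** Membership in the [s]-th power of the irrelevant ideal. *)
Definition order_ge (s : nat) f : Prop := forall m, m \in msupp f -> (s <= mdeg m)%N.

Lemma order_ge0 s : order_ge s 0.
Proof. by move=> m; rewrite msupp0. Qed.

Lemma order_geD s f g : order_ge s f -> order_ge s g -> order_ge s (f + g).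
Proof. by move=> sf sg m /msuppD_le; rewrite mem_cat => /orP[/sf|/sg]. Qed.

Lemma order_geZ s a f : order_ge s f -> order_ge s (a *: f).
Proof. by move=> sf m /msuppZ_le/sf. Qed.

Lemma order_geM s t f g : order_ge s f -> order_ge t g -> order_ge (s + t) (f * g).
Proof.
move=> sf tg m /msuppM_le/allpairsP[[m1 m2] /= [/sf s1 /tg t2 ->]].
by rewrite mdegD leq_add.
Qed.

Lemma order_geW s t f : (s <= t)%N -> order_ge t f -> order_ge s f.
Proof. by move=> lest tf m /tf; apply: leq_trans. Qed.

Variables (q : 'I_u -> R) (N : nat).
Hypothesis q_const : forall j, (q j)@_0 = 0.
Hypothesis q_power : forall k, in_ideal q ('X_k ^+ N).

Definition gen_power al : R := \prod_j q j ^+ al j.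

Lemma gen_powerS al i : gen_power (al + U_(i)) = gen_power al * q i.
Proof.
rewrite /gen_power -[X in _ * X](_ : \prod_j q j ^+ (U_(i)%MM j) = _).
  by rewrite -big_split; apply: eq_bigr => j _; rewrite mnmDE exprD.
rewrite (bigD1 i) //= mnm1E eqxx big1 ?mulr1 // => j /negPf nji.
by rewrite mnm1E eq_sym nji.
Qed.

Lemma order_ge_gen_power al : order_ge (mdeg al) (gen_power al).
Proof.
have q1 j k : order_ge k (q j ^+ k).
  elim: k => [|k IH] m //; rewrite exprS; apply: (order_geM (s := 1)) => // m'.
  rewrite mcoeff_msupp lt0n mdeg_eq0; apply: contraNneq => ->.
  by rewrite q_const.
rewrite mdegE /gen_power; elim/big_rec2: _ => [//|j s f _ sf].
by apply: order_geM.
Qed.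

(** The monomials with all exponents below [t], indexed by a finite type so that they can be
    counted. *)
Definition box_mnm k t (b : {ffun 'I_k -> 'I_t}) : 'X_{1..k} :=
  [multinom b i : nat | i < k].

Lemma mdeg_box_mnm k t (b : {ffun 'I_k -> 'I_t}) : (mdeg (box_mnm b) <= k * t)%N.
Proof.
rewrite mdegE -[k in (k * t)%N]card_ord -sum_nat_const; apply: leq_sum => i _.
by rewrite mnmE ltnW.
Qed.

Lemma box_mnmP k t (m : 'X_{1..k}) :
  (forall i, m i < t)%N -> exists b : {ffun 'I_k -> 'I_t}, m = box_mnm b.
Proof.
move=> mt; exists [ffun i => Ordinal (mt i)]; apply/mnmP => i.
by rewrite mnmE ffunE.
Qed.

Lemma box_mnm_inj k t : injective (@box_mnm k t).
Proof.
move=> b b' /mnmP ebb; apply/ffunP => i; apply/val_inj.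
by have := ebb i; rewrite !mnmE.
Qed.

(** A monomial outside the box is divisible by some ['X_k ^+ N], hence lies in the ideal of the
    [q j]. *)
Lemma box_decomposition f :
  exists c : {ffun 'I_p -> 'I_N} -> K,
    in_ideal q (f - \sum_b c b *: 'X_[box_mnm b]).
Proof.
rewrite [f]mpolyE; elim/big_ind: _ => [|f1 f2 [c1 f1c] [c2 f2c]|m _].
- exists (fun=> 0); rewrite big1 ?subr0; first exact: in_ideal0.
  by move=> b _; rewrite scale0r.
- exists (fun b => c1 b + c2 b).
  suff -> : f1 + f2 - \sum_b (c1 b + c2 b) *: 'X_[box_mnm b] =
     f1 - \sum_b c1 b *: 'X_[box_mnm b] + (f2 - \sum_b c2 b *: 'X_[box_mnm b]).
    exact: in_idealD.
  rewrite addrACA -opprD -big_split; congr (_ - _).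
  by apply: eq_bigr => b _; rewrite scalerDl.
have [/forallP/box_mnmP[b ->]|] := boolP [forall i, m i < N]%N.
  exists (fun b' => if b' == b then f@_(box_mnm b) else 0).
  rewrite (bigD1 b) //= eqxx big1.
    by rewrite addr0 subrr; apply: in_ideal0.
  by move=> b' /negPf->; rewrite scale0r.
rewrite negb_forall => /existsP[k]; rewrite -leqNgt => leNm.
exists (fun=> 0); rewrite big1 ?subr0; last by move=> b _; rewrite scale0r.
have leN : (U_(k) *+ N <= m)%MM.
  apply/mnm_lepP => i; rewrite mulmnE mnm1E.
  by case: eqP => [<-|_]; rewrite ?mul1n ?mul0n.
rewrite -(submK leN) mpolyXD -mpolyXn scalerAl; exact: in_idealM.
Qed.

Definition box_elt s (i : {ffun 'I_p -> 'I_N} * {ffun 'I_u -> 'I_s}) : R :=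
  'X_[box_mnm i.1] * gen_power (box_mnm i.2).

Definition box_span s f : Prop :=
  exists c : {ffun 'I_p -> 'I_N} * {ffun 'I_u -> 'I_s} -> K,
    order_ge s (f - \sum_i c i *: box_elt i).

Lemma box_span_order s f : order_ge s f -> box_span s f.
Proof.
move=> sf; exists (fun=> 0); rewrite big1 ?subr0 // => i _.
by rewrite scale0r.
Qed.

Lemma box_spanD s f g : box_span s f -> box_span s g -> box_span s (f + g).
Proof.
move=> [c1 s1] [c2 s2]; exists (fun i => c1 i + c2 i).
suff -> : f + g - \sum_i (c1 i + c2 i) *: box_elt i =
   f - \sum_i c1 i *: box_elt i + (g - \sum_i c2 i *: box_elt i).
  exact: order_geD.
rewrite addrACA -opprD -big_split; congr (_ - _).
by apply: eq_bigr => b _; rewrite scalerDl.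
Qed.

Lemma box_spanZ s a f : box_span s f -> box_span s (a *: f).
Proof.
move=> [c sc]; exists (fun i => a * c i).
suff -> : a *: f - \sum_i (a * c i) *: box_elt i = a *: (f - \sum_i c i *: box_elt i).
  exact: order_geZ.
rewrite scalerBr scaler_sumr; congr (_ - _).
by apply: eq_bigr => i _; rewrite scalerA.
Qed.

Lemma box_span_elt s i : box_span s (box_elt (s := s) i).
Proof.
exists (fun j => (j == i)%:R); rewrite (bigD1 i) //= eqxx scale1r big1.
  by rewrite addr0 subrr; apply: order_ge0.
by move=> j /negPf->; rewrite scale0r.
Qed.

(* Expanding the coefficient of [gen_power al] modulo the [q j] raises the
   degree of [al] until the remainder has order at least [s]. *)
Lemma box_span_gen_power s t al f :
  (s <= mdeg al + t)%N -> box_span s (f * gen_power al).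
Proof.
elim: t al f => [|t IH] al f le_s.
  apply: box_span_order; rewrite addn0 in le_s; apply: order_geW le_s _.
  by rewrite -[mdeg al]add0n; apply: order_geM; last exact: order_ge_gen_power.
have [les|lts] := leqP s (mdeg al).
  by apply: IH; apply: leq_trans (leq_addr _ _).
have [c [g fE]] := box_decomposition f.
rewrite -[f](subrK (\sum_b c b *: 'X_[box_mnm b])) fE mulrDl.
apply: box_spanD.
  rewrite mulr_suml; elim/big_ind: _ => [||j _].
  - exact/box_span_order/order_ge0.
  - exact: box_spanD.
  rewrite -mulrA [q j * _]mulrC -gen_powerS; apply: IH.
  by rewrite mdegD mdeg1 addn1 addSnnS.
(* As [mdeg al] is below [s], each exponent of [al] is too, and the reduced terms are scalar
   multiples of box elements. *)
have [a alE] : exists a : {ffun 'I_u -> 'I_s}, al = box_mnm a.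
  apply: box_mnmP => j; apply: leq_ltn_trans lts.
  by rewrite mdegE (bigD1 j) //= leq_addr.
rewrite mulr_suml; elim/big_ind: _ => [||b _].
- exact/box_span_order/order_ge0.
- exact: box_spanD.
rewrite -scalerAl alE; apply: box_spanZ; exact: (box_span_elt (b, a)).
Qed.

(** The [t ^ p] box monomials have degree below [s], where a remainder of order at least [s] is
    invisible. So their coordinate vectors are spanned by those of the [N ^ p * s ^ u] box
    elements. *)
Lemma box_count t : (t ^ p <= N ^ p * (p * t).+1 ^ u)%N.
Proof.
set s := (p * t).+1.
pose I : finType := ({ffun 'I_p -> 'I_N} * {ffun 'I_u -> 'I_s})%type.
pose J : finType := {ffun 'I_p -> 'I_t}.
have cI : #|I| = (N ^ p * s ^ u)%N by rewrite card_prod !card_ffun !card_ord.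
have cJ : #|J| = (t ^ p)%N by rewrite card_ffun !card_ord.
rewrite -cI -cJ.
pose M := \matrix_(i < #|I|, j < #|J|)
  (box_elt (enum_val i : I))@_(box_mnm (enum_val j : J)).
suff : (1%:M <= M)%MS.
  by move=> /mxrankS; rewrite mxrank1 => /leq_trans; apply; apply: rank_leq_row.
apply/row_subP => j.
have [c sc] : box_span s ('X_[box_mnm (enum_val j : J)]).
  have -> : 'X_[box_mnm (enum_val j : J)] =
            'X_[box_mnm (enum_val j : J)] * gen_power 0.
    by rewrite /gen_power big1 ?mulr1 // => i _; rewrite mnm0E.
  by apply: (@box_span_gen_power s s); rewrite leq_addl.
apply/submxP; exists (\row_i c (enum_val i)); apply/rowP => j'.
rewrite !mxE; set m' := box_mnm (enum_val j' : J).
have : ('X_[box_mnm (enum_val j : J)] - \sum_i c i *: box_elt i)@_m' = 0.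
  apply: memN_msupp_eq0; apply/negP => /sc; apply/negP; rewrite -ltnNge ltnS.
  exact: mdeg_box_mnm.
rewrite mcoeffB mcoeffX (inj_eq (@box_mnm_inj _ _)) (inj_eq enum_val_inj).
move=> /eqP; rewrite subr_eq0 => /eqP->.
rewrite raddf_sum (reindex (@enum_val I predT)) /=; last first.
  by apply: onW_bij; apply: enum_val_bij.
by apply: eq_bigr => i _; rewrite !mxE mcoeffZ.
Qed.

Lemma height_bound : (p <= u)%N.
Proof.
rewrite leqNgt; apply/negP => ltup.
(* With [t = C.+1] the count is at most [C * C.+1 ^ u], which is less than [C.+1 ^ u.+1] and hence
   than [t ^ p] when [u < p]. *)
pose C := (N ^ p * p.+1 ^ u)%N.
have := box_count C.+1; apply/negP; rewrite -ltnNge.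
have mono a b e : (a <= b -> a ^ e <= b ^ e)%N by case: e => // e; rewrite leq_exp2r.
have le1 : ((p * C.+1).+1 <= p.+1 * C.+1)%N by rewrite mulSn addSn ltnS leq_addl.
apply: (@leq_ltn_trans (C * C.+1 ^ u)).
  rewrite {1}/C -[leqRHS]mulnA leq_mul2l -expnMn; apply/orP; right.
  exact: mono.
apply: (@leq_trans (C.+1 ^ u.+1)); last exact: leq_pexp2l.
by rewrite expnS ltn_mul2r expn_gt0 ltnSn.
Qed.
End HeightBound.

(** * Lower bounds *)

Section LowerBounds.
Variables (K : fieldType) (n : nat).
Local Notation R := {mpoly K[n]}.
Implicit Types (A D T : {set 'I_n}) (L : seq {set 'I_n}) (ys : seq 'I_n).

Lemma min_cover_le_ara mu (S : 'I_mu -> {set 'I_n}) ys u :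
  min_cover (codom S) ys -> ara_witness K S u -> (size ys <= u)%N.
Proof.
move=> [uys cov mc] [q qS]; pose p := size ys.
(* The elements of the cover become the [p] variables, and all other variables are set to 1. *)
pose h i : {mpoly K[p]} := if insub (index i ys) is Some k then 'X_k else 1.
have hys i : i \in ys -> exists k, h i = 'X_k.
  by rewrite -index_mem /h => iy; exists (Ordinal iy);
    rewrite (@insubT _ (fun m => m < p)%N _ _ iy).
have hNys i : i \notin ys -> h i = 1.
  by rewrite -index_mem -/p /h => iy; rewrite insubN.
have hnth (k : 'I_p) : h (tnth (in_tuple ys) k) = 'X_k.
  rewrite /h (tnth_nth (tnth (in_tuple ys) k)) /= index_uniq ?ltn_ord //.
  by rewrite -[X in insub X]/(val k) valK.
pose phi : {rmorphism R -> {mpoly K[p]}} := mmap (@mpolyC p K) h.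
have phiX D : phi (sqfree_monomial K D) = \prod_(i in D) h i.
  rewrite rmorph_prod; apply: eq_bigr => i _.
  by rewrite /= mmapX mmap1U.
have phi_ideal k (g : 'I_k -> R) f : in_ideal g f -> in_ideal (phi \o g) (phi f).
  move=> [c ->]; exists (phi \o c); rewrite rmorph_sum.
  by apply: eq_bigr => j _; rewrite rmorphM.
(* Every generator involves a variable of the cover, so its image has no constant term. *)
have phi0 f : in_radical (mon_gens K S) f -> (phi f)@_0 = 0.
  move=> [e /phi_ideal[c fe]]; apply/eqP.
  have : (phi f ^+ e)@_0 == 0.
    rewrite -rmorphXn fe raddf_sum big1 // => j _ /=.
    have [y yys yS] := cov _ (codom_f S j); have [k hy] := hys y yys.
    rewrite /mon_gens phiX (bigD1 y) //= hy.
    by rewrite !rmorphM /= mcoeffX mnm1_eq0 mul0r mulr0.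
  by rewrite rmorphXn expf_eq0 => /andP[].
(* The generator of the private set of [y] is mapped exactly to the variable of [y]. *)
have [e he] : exists e : 'I_p -> nat, forall k, in_ideal (phi \o q) ('X_k ^+ e k).
  suff /fin_all_exists[e he] k : exists e, in_ideal (phi \o q) ('X_k ^+ e).
    by exists e.
  set y := tnth (in_tuple ys) k.
  have yys : y \in ys by apply: mem_tnth.
  have [_ /codomP[j ->] [yS uS]] := mc y yys.
  have /qS[e /phi_ideal qe] : in_radical (mon_gens K S) (mon_gens K S j).
    exact/in_radical_ideal/in_ideal_gen.
  exists e; move: qe; rewrite rmorphXn /mon_gens /= phiX (bigD1 y) //= hnth.
  rewrite big1 ?mulr1 //.
  move=> i /andP[iS niy]; apply: hNys; apply: contra niy => iys.
  by apply/eqP; apply: uS.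
apply: (@height_bound K p u (phi \o q) (\sum_k e k)) => [j|k].
  by apply/phi0/qS/in_radical_ideal/in_ideal_gen.
by rewrite (bigD1 k) //= addnC exprD; apply: in_idealM.
Qed.

(** Vanishing of a row modulo the ideal of [L], stated without forming the quotient ring. *)
Definition row_in L r (v : 'rV[R]_r) : Prop := forall j, mon_ideal L (v 0 j).

Lemma row_in0 L r : row_in L (0 : 'rV_r).
Proof. by move=> j; rewrite mxE; apply: mon_ideal0. Qed.

Lemma row_inD L r (v w : 'rV_r) : row_in L v -> row_in L w -> row_in L (v + w).
Proof. by move=> Lv Lw j; rewrite mxE; apply: mon_idealD. Qed.

Lemma row_inZ L r a (v : 'rV_r) : row_in L v -> row_in L (a *: v).
Proof. by move=> Lv j; rewrite mxE; apply: mon_ideal_mull. Qed.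

Lemma row_inB L r (v w : 'rV_r) : row_in L v -> row_in L w -> row_in L (v - w).
Proof.
by move=> Lv Lw; rewrite -scaleN1r; apply: row_inD => //; apply: row_inZ.
Qed.

Lemma row_in_mulmx L r s (v : 'rV_r) (M : 'M_(r, s)) :
  row_in L v -> row_in L (v *m M).
Proof.
move=> Lv; rewrite mulmx_sum_row; elim/big_ind: _ => [||i _].
- exact: row_in0.
- exact: row_inD.
by move=> j; rewrite mxE mulrC; apply: mon_ideal_mull.
Qed.

Lemma row_in_nil r (v : 'rV_r) : row_in [::] v <-> v = 0.
Proof.
split=> [v0|->]; last exact: row_in0.
by apply/rowP => j; rewrite mxE; apply/mon_ideal_nil.
Qed.

Lemma row_in_sub L L' r (v : 'rV_r) :
  {subset L <= L'} -> row_in L v -> row_in L' v.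
Proof.
move=> sL Lv j; apply: mon_ideal_sub (Lv j) => A AL.
by exists A => //; apply: sL.
Qed.

Local Notation X y := (sqfree_monomial K [set y]).

(** A variable outside all sets of [L] is regular modulo [L], since the colon by it leaves [L]
    unchanged. *)
Lemma row_in_cancel L r y (v : 'rV_r) :
  all (fun D : {set _} => [disjoint [set y] & D]) L ->
  row_in L (X y *: v) -> row_in L v.
Proof.
move=> dy Lv j; have := Lv j; rewrite mxE mulrC => /mon_ideal_colon.
by rewrite map_setD_disjoint.
Qed.

Lemma row_in_cons L r y (v : 'rV_r) :
  row_in ([set y] :: L) v -> exists w, row_in L (v - X y *: w).
Proof.
move=> Lv; have /fin_all_exists[c cP] j : exists c, mon_ideal L (v 0 j - X y * c).
  have /mon_ideal_cons[c [g [Lg ->]]] := Lv j.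
  by exists c; rewrite [X y * c]mulrC addrK.
by exists (\row_j c j) => j; rewrite !mxE.
Qed.

Lemma row_in_scale_head L r y (v : 'rV_r) : row_in ([set y] :: L) (X y *: v).
Proof.
move=> j; rewrite mxE mulrC; apply/mon_ideal_mull/mon_idealX; exact: mem_head.
Qed.

(* Each step reduces modulo one variable [y], which is regular on the module of
   syzygies: the truncated complex stays exact, and if [y *: z] is the image
   of [z1] then [z1] plays the role of [z] one step further. *)
Lemma resolution_length k (s : nat -> nat) (d : forall i, 'M[R]_(s i.+1, s i))
    ys L j (z : 'rV_(s j)) :
  (forall i, (k < i)%N -> s i = 0%N) -> (forall i, d i.+1 *m d i = 0) ->
  uniq ys ->
  (forall y, y \in ys -> all (fun D : {set _} => [disjoint [set y] & D]) L) ->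
  (forall i (v : 'rV_(s i.+1)), (j <= i)%N -> row_in L (v *m d i) ->
     exists u, row_in L (v - u *m d i.+1)) ->
  ~ (exists u, row_in L (z - u *m d j)) ->
  (forall y, y \in ys -> exists u, row_in L (X y *: z - u *m d j)) ->
  (j + size ys <= k)%N.
Proof.
move=> s0 dd; elim: ys L j z => [|y ys IH] L j z.
  (* Beyond [k] the module is zero, so [z] would trivially be a boundary. *)
  move=> _ _ _ nz _; rewrite addn0 leqNgt; apply/negP => /s0 sj.
  apply: nz; exists 0; rewrite mul0mx subr0 => i.
  by have := ltn_ord i; rewrite {2}sj.
rewrite /= => /andP[yys uys] dys exL nz kz.
have dy := dys y (mem_head _ _).
have [z1 z1P] := kz y (mem_head _ _).
have LL' r (v : 'rV_r) : row_in L v -> row_in ([set y] :: L) v.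
  by apply: row_in_sub => D DL; rewrite in_cons DL orbT.
rewrite addnS -addSn; apply: (IH ([set y] :: L) j.+1 z1) => //.
- move=> y' y'ys; rewrite /= dys ?in_cons ?y'ys ?orbT // andbT.
  by rewrite disjoints1 inE; apply: contraNneq yys => <-.
(* Exactness modulo [y]: if [v] maps to a multiple [X y *: w], then regularity makes [w] a cycle,
   hence the image of some [u], and [v - X y *: u] is a cycle modulo [L]. *)
- case=> // i v leji /row_in_cons[w vw].
  have [||u wu] := exL i w; [exact: leji| |].
    apply: (row_in_cancel dy); have := row_in_mulmx (M := d i) vw.
    rewrite mulmxBl -mulmxA dd mulmx0 sub0r -scalemxAl => /(row_inZ (a := -1)).
    by rewrite scaleN1r opprK.
  have [||u' vu'] := exL i.+1 (v - X y *: u); [exact: leqW| |].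
    have -> : (v - X y *: u) *m d i.+1 =
        (v *m d i.+1 - X y *: w) + X y *: (w - u *m d i.+1).
      by rewrite mulmxBl scalerBr addrA subrK -scalemxAl.
    by apply: row_inD => //; apply: row_inZ.
  exists u'; have -> : v - u' *m d i.+2 = v - X y *: u - u' *m d i.+2 + X y *: u.
    by rewrite addrAC subrK.
  by apply: row_inD; [apply: LL'|apply: row_in_scale_head].
(* If [z1] were a boundary modulo [y], applying [d j] and cancelling [X y] would make [z] a
   boundary. *)
- move=> [u /row_in_cons[w /(row_in_mulmx (M := d j))]].
  rewrite !mulmxBl -mulmxA dd mulmx0 subr0 -scalemxAl => zw.
  apply: nz; exists w; apply: (row_in_cancel dy); rewrite scalerBr.
  by have := row_inD z1P zw; rewrite addrA subrK.
(* Both [X y' *: z1] and [X y *: u'] map to [X y * X y' *: z] modulo [L], so their difference is a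
   cycle and thus a boundary. *)
move=> y' y'ys; have [|u' u'P] := kz y'; first by rewrite in_cons y'ys orbT.
have [||u uP] := exL j (X y' *: z1 - X y *: u'); [exact: leqnn| |].
  have -> : (X y' *: z1 - X y *: u') *m d j =
      X y *: (X y' *: z - u' *m d j) - X y' *: (X y *: z - z1 *m d j).
    rewrite mulmxBl -!scalemxAl !scalerBr !scalerA [X y' * X y]mulrC.
    by rewrite opprB [RHS]addrC addrA subrK.
  by apply: row_inB; apply: row_inZ.
exists u; have -> : X y' *: z1 - u *m d j.+1 =
    X y' *: z1 - X y *: u' - u *m d j.+1 + X y *: u' by rewrite addrAC subrK.
by apply: row_inD; [apply: LL'|apply: row_in_scale_head].
Qed.

Lemma min_cover_le_resolution mu (S : 'I_mu -> {set 'I_n}) ys k :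
  min_cover (codom S) ys -> free_resolution_le K S k -> (size ys <= k)%N.
Proof.
move=> [uys cov mc] [r [d [r0 [d0 dE]]]].
have eS f : mon_ideal (codom S) f <-> exists u : 'rV_(rank_seq r 1), (u *m d 0%N) 0 0 = f.
  exact: iff_trans (iff_sym (in_ideal_mon_gens _ _)) (iff_sym (d0 f)).
pose T := [set i | i \notin ys].
pose z : 'rV[R]_(rank_seq r 0) := (sqfree_monomial K T)%:M.
apply: (@resolution_length k (rank_seq r) d ys [::] 0%N z) => // [i|i v _||y yys].
- apply/row_matrixP => l; rewrite row_mul row0; apply/dE.
  by exists (delta_mx 0 l); rewrite rowE.
- move=> /row_in_nil/dE[u ->]; exists u; rewrite subrr; exact: row_in0.
(* The monomial of [T] is not in the ideal: every generator involves a variable of [ys], while [T]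
   contains none. *)
- move=> [u /row_in_nil/eqP]; rewrite subr_eq0 => /eqP zu.
  have /eS : exists u : 'rV_(rank_seq r 1), (u *m d 0%N) 0 0 = sqfree_monomial K T.
    by exists u; rewrite -zu mxE mulr1n.
  rewrite sqfree_monomialE => /(_ (mesym1 T)) /[!msuppX] /(_ (mem_head _ _)).
  case/hasP=> A /cov[y yys yA] /subsetP/(_ y yA).
  by rewrite mnm_set_mesym1 inE yys.
(* The private set of [y] is contained in [T] together with [y], so multiplication by [y] brings the
   monomial of [T] into the ideal. *)
have [D DS [yD uD]] := mc y yys.
have /eS[u uE] : mon_ideal (codom S) (X y * sqfree_monomial K T).
  move=> m; rewrite !sqfree_monomialE -mpolyXD => /mem_msuppXP <-.
  apply/hasP; exists D => //; apply/subsetP => i iD.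
  rewrite mnm_setD !mnm_set_mesym1 !inE; have [iys|//] := boolP (i \in ys).
    by rewrite (uD i iys iD) eqxx.
  by rewrite orbT.
exists u; apply/row_in_nil; apply/rowP => i.
by rewrite !ord1; apply/eqP; rewrite !mxE subr_eq0 mulr1n -uE mxE.
Qed.
End LowerBounds.

(** * String hypergraphs *)

Section StringHypergraphs.
Local Open Scope nat_scope.

Lemma sparse_nth (T : finType) (L : seq {set T}) :
  (forall j k, j.+1 < k -> k < size L ->
     [disjoint nth set0 L j & nth set0 L k]) -> sparse L.
Proof.
elim: L => //= A L IH dL; apply/andP; split; last first.
  by apply: IH => j k ltjk ltk; apply: (dL j.+1 k.+1).
apply/(all_nthP set0) => k; rewrite size_behead => ltk.
rewrite nth_behead; apply: (dL 0 k.+2) => //.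
by rewrite ltnS -ltn_predRL.
Qed.

Variables (n mu : nat) (S : 'I_mu -> {set 'I_n}).
Hypothesis antichain : forall j k : 'I_mu, j != k -> ~~ (S j \subset S k).
Hypothesis string_S : is_string (hypergraph S).

Lemma nth_codom_ord (j : 'I_mu) : nth set0 (codom S) j = S j.
Proof. by rewrite /codom (nth_map j) ?size_enum_ord // nth_ord_enum. Qed.

(** A variable shared by two generators yields a face through both vertices, and faces of a string
    join only neighbours. *)
Lemma string_sparse : sparse (codom S).
Proof.
have [_ [_ faces]] := string_S; apply: sparse_nth => j k ltjk.
rewrite size_codom card_ord => ltk.
have ltj : j < mu by apply: ltn_trans ltk; apply: ltn_trans ltjk.
rewrite (nth_codom_ord (Ordinal ltj)) (nth_codom_ord (Ordinal ltk)).
rewrite -setI_eq0; apply/negPn/negP => /set0Pn[i /setIP[iSj iSk]].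
have /faces face : [set l | i \in S l] \in hypergraph S.
  by apply: imset_f; apply/bigcupP; exists (Ordinal ltj).
have jF : Ordinal ltj \in [set l | i \in S l] by rewrite inE.
have kF : Ordinal ltk \in [set l | i \in S l] by rewrite inE.
case: face => [/eqP/cards1P[l Fl]|[a [b [ba Fab]]]].
  move: jF kF; rewrite Fl !inE => /eqP<- /eqP[kj].
  by rewrite kj ltnNge leqnSn in ltjk.
rewrite Fab !inE -!val_eqE /= ba in jF kF.
suff kj : k <= j.+1 by rewrite ltnNge kj in ltjk.
by case/orP: jF => /eqP->; case/orP: kF => /eqP-> //; rewrite leqW.
Qed.

Lemma string_sorted : sorted (@linked _) (codom S).
Proof.
have [_ [edges _]] := string_S; apply/(sortedP set0) => j.
rewrite size_codom card_ord => ltj1.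
pose a := Ordinal (ltnW ltj1); pose b := Ordinal ltj1.
rewrite (nth_codom_ord a) (nth_codom_ord b).
have nab : a != b by rewrite -val_eqE /= neq_ltn ltnSn.
apply/and3P; split; [|exact: antichain|by apply: antichain; rewrite eq_sym].
have /imsetP[i _ eF] := edges a b erefl; apply/set0Pn; exists i.
have /setP eF' := eF; rewrite inE.
have := eF' a; have := eF' b; rewrite !inE !eqxx orbT /= => <- <-.
by [].
Qed.
End StringHypergraphs.

Theorem theorem3p1 (K : fieldType) (n mu : nat) (S : 'I_mu -> {set 'I_n}) :
  (* m_1, ..., m_mu are the minimal generators: pairwise non-dividing *)
  (forall j k : 'I_mu, j != k -> ~~ (S j \subset S k)) ->
  is_string (hypergraph S) ->
  exists p : nat,
    is_min (ara_witness K S) p /\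
    is_min (biara_witness K S) p /\
    is_min (free_resolution_le K S) p.
Proof.
move=> antichain string_S.
have spS := string_sparse string_S.
have lkS := string_sorted antichain string_S.
(* The length of one list is both the cost of a chain, for the upper bounds, and the size of a
   minimal cover, for the lower bounds. *)
have [ys [chS covS]] : exists ys, chain (codom S) (size ys) /\ min_cover (codom S) ys.
  have := size_codom S; rewrite card_ord; have [ge2 _] := string_S.
  case: (codom S) spS lkS => [|A [|B L]] spS lkS sz; rewrite -sz // in ge2.
  exact: chain_min_cover.
have biara := chain_biara_witness K chS.
exists (size ys); split; [|split]; split=> [|k].
- exact: biara_ara_witness.
- exact: min_cover_le_ara.
- exact: biara.
- by move/biara_ara_witness; apply: min_cover_le_ara.
- exact: chain_free_resolution.
- exact: min_cover_le_resolution.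
Qed.
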